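(* Let $A=[a_{ij}]$ be a fully indecomposable $n\times n$ $(0,1)$-matrix with row sum vector $(r_1,\ldots,r_n)$ and column sum vector $(s_1,\ldots,s_n)$. (i) Let $u=(u_1,\ldots,u_n)$ and $v=(v_1,\ldots,v_n)$ be real vectors, and define $Y=Y(u,v)=[y_{ij}]$ by $y_{ij}=u_i+v_j$ if $a_{ij}=1$ and $y_{ij}=0$ otherwise. Assume that $y_{ij}>0$ whenever $a_{ij}=1$, and that all row and column sums of $Y$ equal some positive number $\alpha$, i.e. \[ u_ir_i+\sum_{j:\,a_{ij}=1}v_j=\alpha\ (i\le n),\qquad v_js_j+\sum_{i:\,a_{ij}=1}u_i=\alpha\ (j\le n). \] Then $X=(1/\alpha)Y(u,v)$ is an RCDS doubly stochastic matrix determined by $A$. (ii) Conversely, if $X$ is an RCDS doubly stochastic matrix determined by $A$, then $X=(1/\alpha)Y(u,v)$ as in (i) for some real vectors $u,v$, where $\alpha$ is the common value of the row and column sums of $Y(u,v)$.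
   Context: A square nonnegative matrix is doubly stochastic if all its row and column sums equal $1$. An $n\times n$ matrix is partly decomposable if, after permuting rows and columns, it has the form $\begin{bmatrix}A_1&A_2\\ O&A_3\end{bmatrix}$ with $A_1,A_3$ square and nonempty; otherwise it is fully indecomposable. For a permutation $\sigma$ of $\{1,\ldots,n\}$, the diagonal of an $n\times n$ matrix $X=[x_{ij}]$ corresponding to $\sigma$ is the set of positions $(i,\sigma(i))$, $i=1,\ldots,n$, and its diagonal sum is $\sum_i x_{i,\sigma(i)}$. For a matrix $X$, $\xi(X)$ denotes the set of positions of its zero entries; a diagonal avoids $\xi(X)$ if none of its positions lies in $\xi(X)$. Given a fully indecomposable $(0,1)$-matrix $A$, an RCDS doubly stochastic matrix determined by $A$ is a doubly stochastic matrix $X$ with $\xi(X)=\xi(A)$ such that all diagonals of $X$ avoiding $\xi(X)$ have the same diagonal sum. *)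

(* Defs.v *)
From mathcomp Require Export all_boot all_order all_fingroup all_algebra.
From mathcomp Require Export reals.

Set Implicit Arguments.
Unset Strict Implicit.
Unset Printing Implicit Defensive.

Import Order.TTheory GRing.Theory Num.Theory.
Local Open Scope ring_scope.

Section Definitions.
Variables (R : realType) (n : nat).
Implicit Types (A X : 'M[R]_n) (s : 'S_n) (u v : 'rV[R]_n).

Definition zero_one A : Prop := forall i j, A i j = 0 \/ A i j = 1.

Definition row_sum X (i : 'I_n) : R := \sum_j X i j.
Definition col_sum X (j : 'I_n) : R := \sum_i X i j.

Definition doubly_stochastic X : Prop :=
  [/\ forall i j, 0 <= X i j,
      forall i, row_sum X i = 1
    & forall j, col_sum X j = 1].

Definition partly_decomposable A : Prop :=
  exists (k m : nat) (e : (k + m)%N = n) (s t : 'S_n)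
         (A1 : 'M[R]_k) (A2 : 'M[R]_(k, m)) (A3 : 'M[R]_m),
    [/\ (0 < k)%N, (0 < m)%N
      & row_perm s (col_perm t A) = castmx (e, e) (block_mx A1 A2 0 A3)].

Definition fully_indecomposable A : Prop := ~ partly_decomposable A.

Definition diagonal s : {set 'I_n * 'I_n} := [set (i, s i) | i : 'I_n].

Definition diag_sum X s : R := \sum_i X i (s i).

Definition zeros X : {set 'I_n * 'I_n} := [set p | X p.1 p.2 == 0].

Definition avoids s (Z : {set 'I_n * 'I_n}) : Prop := [disjoint diagonal s & Z].

Definition RCDS A X : Prop :=
  [/\ doubly_stochastic X,
      zeros X = zeros A
    & forall s t, avoids s (zeros X) -> avoids t (zeros X) ->
        diag_sum X s = diag_sum X t].

Definition Ymx A u v : 'M[R]_n :=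
  \matrix_(i, j) (if A i j == 1 then u 0 i + v 0 j else 0).

Definition Ypositive A u v : Prop :=
  forall i j, A i j = 1 -> 0 < Ymx A u v i j.

Definition Yline_sums A u v (alpha : R) : Prop :=
  (forall i, row_sum (Ymx A u v) i = alpha) /\
  (forall j, col_sum (Ymx A u v) j = alpha).

End Definitions.

(* Main.v *)
Require Import Defs.
From HB Require Import structures.
From mathcomp Require Import zify ring lra.

(** A matrix u_i + v_j has the same sum along every diagonal inside the
    pattern, namely the sum of all u_i and v_j; this is the first half.

    For the converse, let <X, M> be the entrywise inner product, so that the
    diagonal sums of X are its products with permutation matrices. If all
    diagonals of X inside the pattern sum to c, then by Birkhoff's theorem
    <X, M> = c t for every nonnegative M inside the pattern whose line sums are
    all t. If Z lies inside the pattern and has zero line sums, then K X + Z is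
    nonnegative for K large, because X is positive on the pattern; comparing its
    product with X to that of K X gives <X, Z> = 0. Now (u, v) -> Y(u, v) is a
    linear map whose adjoint sends Z to the line sums of its part inside the
    pattern, and X is orthogonal to the kernel of the adjoint: it is therefore
    of the form Y(u, v). *)

Set Implicit Arguments.
Unset Strict Implicit.
Unset Printing Implicit Defensive.

Import Order.TTheory GRing.Theory Num.Theory.
Local Open Scope ring_scope.

Section Hall.
Local Open Scope nat_scope.
Variables I J : finType.
Implicit Types (N : I -> {set J}) (S T : {set I}).

Definition hall_condition N : Prop :=
  forall T, #|T| <= #|\bigcup_(k in T) N k|.

Definition discard N i y : I -> {set J} :=
  fun k => if k == i then N k :\ y else N k.

Lemma discard_subset N i y k : discard N i y k \subset N k.
Proof. by rewrite /discard; case: eqP => // _; apply: subD1set. Qed.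

Lemma bigcup_discard N i y T : i \notin T ->
  \bigcup_(k in T) discard N i y k = \bigcup_(k in T) N k.
Proof.
move=> iT; apply: eq_bigr => k kT; rewrite /discard ifN //.
by apply: contraNneq iT => <-.
Qed.

Lemma sum_card_discard N i y : y \in N i ->
  \sum_k #|discard N i y k| < \sum_k #|N k|.
Proof.
move=> yN; rewrite (bigD1 i) //= [ltnRHS](bigD1 i) //= -addSn leq_add //.
  by rewrite /discard eqxx [ltnRHS](cardsD1 y) yN.
by apply: leq_sum => k _; apply/subset_leq_card/discard_subset.
Qed.

Lemma discard_violation N i y : hall_condition N ->
  hall_condition (discard N i y) \/
  exists2 S : {set I}, i \notin S &
    #|(N i :\ y) :|: \bigcup_(k in S) N k| <= #|S|.
Proof.
move=> hallN.
have [/forallP|/forallPn[T]] := boolP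
  [forall S : {set I}, #|S| <= #|\bigcup_(k in S) discard N i y k|].
  by left.
rewrite -ltnNge => violT; right; have [iT|iT] := boolP (i \in T); last first.
  by move: violT; rewrite bigcup_discard // ltnNge hallN.
have iT' : i \notin T :\ i by rewrite setD11.
exists (T :\ i); rewrite // -(bigcup_discard N y iT').
move: violT; rewrite (cardsD1 i) iT ltnS (big_setD1 i) //=.
by rewrite {1}/discard eqxx.
Qed.

(* Rado's argument: if neither of two elements of [N i] could be discarded, then
   adding the inequalities for the two violating sets [S] and [T] would
   contradict the condition for [i |: (S :|: T)] and [S :&: T]. *)
Lemma hall_condition_discard N i : hall_condition N -> 1 < #|N i| ->
  exists2 y, y \in N i & hall_condition (discard N i y).
Proof.
move=> hallN /card_gt1P[x [y [xN yN neq_xy]]].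
have [|[S iS leS]] := discard_violation i x hallN; first by exists x.
have [|[T iT leT]] := discard_violation i y hallN; first by exists y.
pose P := (N i :\ x) :|: \bigcup_(k in S) N k.
pose Q := (N i :\ y) :|: \bigcup_(k in T) N k.
have lePQU : #|S :|: T|.+1 <= #|P :|: Q|.
  have <- : #|i |: (S :|: T)| = #|S :|: T|.+1.
    by rewrite cardsU1 inE negb_or iS iT.
  apply: leq_trans (hallN _) (subset_leq_card _).
  rewrite bigcup_setU big_set1 bigcup_setU; apply/subsetP=> z; rewrite !inE.
  have [->|] := eqVneq z x; first by rewrite neq_xy; lia.
  by lia.
have lePQI : #|S :&: T| <= #|P :&: Q|.
  apply: leq_trans (hallN _) (subset_leq_card _).
  apply/bigcupsP=> k /setIP[kS kT]; rewrite subsetI.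
  by apply/andP; split; apply: subset_trans (subsetUr _ _); apply: bigcup_sup.
have := cardsUI P Q; have := cardsUI S T; rewrite -/P -/Q in leS leT *; by lia.
Qed.

Lemma hall_marriage N : hall_condition N ->
  exists2 f : I -> J, injective f & forall i, f i \in N i.
Proof.
have [m] := ubnP (\sum_i #|N i|); elim: m N => // m IHm N leNm hallN.
have [/existsP[i Ni_gt1]|/existsPn Nle1] := boolP [exists i, 1 < #|N i|].
  have [y yN hallN'] := hall_condition_discard hallN Ni_gt1.
  have [|f f_inj fN] := IHm _ _ hallN'.
    exact: leq_trans (sum_card_discard yN) _.
  by exists f => // k; apply: subsetP (discard_subset N i y k) _ (fN k).
have /fin_all_exists[f Nf] i : exists y, N i = [set y].
  apply/cards1P; rewrite eqn_leq leqNgt Nle1 /=.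
  by have := hallN [set i]; rewrite cards1 big_set1.
exists f => [i k eq_f|i]; last by rewrite Nf set11.
apply/eqP; apply: contraT => neq_ik; have := hallN [set i; k].
by rewrite cards2 neq_ik bigcup_setU !big_set1 !Nf eq_f setUid cards1.
Qed.

End Hall.

Section LineSums.
Variables (R : pzSemiRingType) (n : nat).
Implicit Types (M Z : 'M[R]_n) (s : 'S_n).

Definition line_sums M (t : R) : Prop :=
  (forall i, \sum_j M i j = t) /\ (forall j, \sum_i M i j = t).

Lemma line_sums0 : line_sums 0 0.
Proof. by split=> i; apply: big1 => j _; rewrite mxE. Qed.

Lemma line_sumsD M Z a b :
  line_sums M a -> line_sums Z b -> line_sums (M + Z) (a + b).
Proof.
move=> [Mr Mc] [Zr Zc]; split=> i.
  by rewrite -(Mr i) -(Zr i) -big_split; apply: eq_bigr => j _; rewrite mxE.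
by rewrite -(Mc i) -(Zc i) -big_split; apply: eq_bigr => j _; rewrite mxE.
Qed.

Lemma line_sumsZ M a b : line_sums M a -> line_sums (b *: M) (b * a).
Proof.
move=> [Mr Mc]; split=> i.
  by rewrite -(Mr i) big_distrr; apply: eq_bigr => j _; rewrite mxE.
by rewrite -(Mc i) big_distrr; apply: eq_bigr => j _; rewrite mxE.
Qed.

Lemma line_sums_perm_mx s : line_sums (perm_mx s) 1.
Proof.
split=> i; under eq_bigr do rewrite !mxE.
  rewrite (bigD1 (s i)) //= eqxx big1 ?addr0 // => j /negbTE.
  by rewrite eq_sym => ->.
rewrite (reindex_perm s^-1) /=; under eq_bigr do rewrite permKV.
by rewrite (bigD1 i) //= eqxx big1 ?addr0 // => j /negbTE ->.
Qed.

Lemma line_sums_sum_perm_mx (w : 'S_n -> R) :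
  line_sums (\sum_s w s *: perm_mx s) (\sum_s w s).
Proof.
apply: (big_ind2 line_sums line_sums0) => [M a Z b|s _].
  exact: line_sumsD.
by rewrite -[X in line_sums _ X]mulr1; apply/line_sumsZ/line_sums_perm_mx.
Qed.

End LineSums.

Section Birkhoff.
Variables (R : realDomainType) (n : nat).
Implicit Types (M : 'M[R]_n) (s : 'S_n).

(* Hall's condition for the positive entries: the rows in [T] carry total mass
   [#|T| * t], all of it in the columns of their neighbourhood. *)
Lemma positive_diagonal M t :
  (forall i j, 0 <= M i j) -> line_sums M t -> 0 < t ->
  exists s, forall i, 0 < M i (s i).
Proof.
move=> M0 [Mr Mc] t_gt0; pose N i := [set j | 0 < M i j].
have [T|f f_inj fN] := @hall_marriage _ _ N; last first.
  by exists (perm f_inj) => i; rewrite permE; have := fN i; rewrite inE.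
set P := \bigcup_(i in T) N i.
rewrite -(ler_nat R) -(ler_pM2l t_gt0) !mulr_natr -!sumr_const.
rewrite -(eq_bigr _ (fun i _ => Mr i)) -(eq_bigr _ (fun j _ => Mc j)).
rewrite [leRHS]exchange_big /=.
apply: (@le_trans _ _ (\sum_(i in T) \sum_(j in P) M i j)).
  apply: ler_sum => i iT; rewrite (bigID (mem P)) /= [X in _ + X]big1 ?addr0 //.
  move=> j jP; apply/eqP; rewrite eq_le M0 andbT leNgt.
  by apply: contra jP => Mij; apply/bigcupP; exists i; rewrite ?inE.
rewrite [leRHS](bigID (mem T)) /= lerDl.
by apply: sumr_ge0 => i _; apply: sumr_ge0.
Qed.

Definition positive_entries M : {set 'I_n * 'I_n} := [set p | 0 < M p.1 p.2].

Lemma peel_diagonal M s (i0 : 'I_n) :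
  (forall i j, 0 <= M i j) -> (forall i, 0 < M i (s i)) ->
  exists e, let M' := M - e *: perm_mx s in
    [/\ 0 <= e, forall i j, 0 <= M' i j
      & positive_entries M' \proper positive_entries M].
Proof.
move=> M0 Ms.
have [k _ kmin] := arg_minP (fun i => M i (s i)) (erefl : xpredT i0).
exists (M k (s k)) => M'.
have M'E i j : M' i j = if s i == j then M i j - M k (s k) else M i j.
  by rewrite !mxE; case: eqP => _; rewrite ?mulr1 // mulr0 subr0.
split=> // [i j|].
  by rewrite M'E; case: eqP => // <-; rewrite subr_ge0 kmin.
apply/properP; split; last first.
  by exists (k, s k); rewrite inE //= M'E eqxx subrr ltxx.
by apply/subsetP=> -[i j]; rewrite !inE M'E /=; case: eqP => // <- _; apply: Ms.
Qed.

(* The positive part of M is exhausted by repeatedly subtracting the largest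
   possible multiple of a permutation matrix on a positive diagonal. *)
Theorem birkhoff M t : (forall i j, 0 <= M i j) -> line_sums M t ->
  exists2 w : 'S_n -> R, forall s, 0 <= w s & M = \sum_s w s *: perm_mx s.
Proof.
have [m] := ubnP #|positive_entries M|; elim: m M t => // m IHm M t leMm M0 Mt.
have [->|/matrix0Pn[i [j Mij]]] := eqVneq M 0.
  by exists (fun=> 0) => //; rewrite big1 // => s _; rewrite scale0r.
have t_gt0 : 0 < t.
  by rewrite -(Mt.1 i) (bigD1 j) //= ltr_pwDl ?sumr_ge0 // lt_def Mij M0.
have [s Ms] := positive_diagonal M0 Mt t_gt0.
have [e [e0 M'0 /proper_card ltM'M]] := peel_diagonal i M0 Ms.
have [||w w0 M'w] := IHm (M - e *: perm_mx s) (t - e) _ M'0.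
- exact: leq_trans ltM'M leMm.
- rewrite -scaleNr -[X in line_sums _ (_ + X)]mulr1.
  by apply/line_sumsD => //; apply/line_sumsZ/line_sums_perm_mx.
exists (fun s' => w s' + (s' == s)%:R * e) => [s'|].
  by rewrite addr_ge0 ?mulr_ge0 ?ler0n.
under eq_bigr do rewrite scalerDl.
rewrite big_split /= -M'w (bigD1 s) //= eqxx mul1r big1 ?addr0 ?subrK //.
by move=> s' /negbTE->; rewrite mul0r scale0r.
Qed.

Lemma sum_perm_mx_gt0 (w : 'S_n -> R) s i :
  (forall s', 0 <= w s') -> w s != 0 ->
  0 < (\sum_s' w s' *: perm_mx s') i (s i).
Proof.
move=> w0 ws; rewrite summxE (bigD1 s) //= ltr_pwDl //.
  by rewrite !mxE eqxx mulr1 lt_def ws w0.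
by apply: sumr_ge0 => s' _; rewrite !mxE mulr_ge0.
Qed.

End Birkhoff.

Section Frobenius.
Variables (R : comPzSemiRingType) (m n : nat).
Implicit Types X M : 'M[R]_(m, n).

Definition frobenius X M : R := \tr (X^T *m M).

HB.instance Definition _ X :=
  GRing.Linear.copy (frobenius X) (mxtrace \o mulmx X^T).

Lemma frobeniusE X M : frobenius X M = \sum_i \sum_j X i j * M i j.
Proof.
rewrite exchange_big; apply: eq_bigr => j _; rewrite mxE.
by apply: eq_bigr => i _; rewrite mxE.
Qed.

Lemma frobenius_mxvec X M : mxvec X *m (mxvec M)^T = (frobenius X M)%:M.
Proof.
apply/matrixP=> i j; rewrite !ord1 !mxE eqxx frobeniusE pair_bigA.
rewrite (reindex _ (curry_mxvec_bij m n)) /=.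
by apply: eq_bigr => -[a b] _; rewrite mxE !mxvecE.
Qed.

End Frobenius.

Lemma frobenius_perm_mx (R : comPzSemiRingType) n (X : 'M[R]_n) s :
  frobenius X (perm_mx s) = \sum_i X i (s i).
Proof.
rewrite frobeniusE; apply: eq_bigr => i _.
rewrite (bigD1 (s i)) //= !mxE eqxx mulr1 big1 ?addr0 // => j /negbTE.
by rewrite !mxE eq_sym => ->; rewrite mulr0.
Qed.

Lemma submx_annihilator (F : fieldType) (m1 m2 n : nat)
    (A : 'M[F]_(m1, n)) (B : 'M[F]_(m2, n)) :
  (forall w : 'cV_n, B *m w = 0 -> A *m w = 0) -> (A <= B)%MS.
Proof.
move=> AB; rewrite submxE; apply/eqP/matrixP=> i k.
have /colP/(_ i) : A *m col k (cokermx B) = 0.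
  by apply: AB; rewrite colE mulmxA mulmx_coker mul0mx.
by rewrite colE mulmxA -colE !mxE.
Qed.

Lemma linear_image_biorthogonal (F : fieldType) (m n p : nat)
    (f : {linear 'rV[F]_m -> 'M[F]_(n, p)}) (X : 'M[F]_(n, p)) :
  (forall Z, (forall d, frobenius (f d) Z = 0) -> frobenius X Z = 0) ->
  exists d, X = f d.
Proof.
move=> Xorth; pose B := lin1_mx (mxvec \o f).
have BE d : d *m B = mxvec (f d) := mul_rV_lin1 _ d.
suff /submxP[d XB] : (mxvec X <= B)%MS.
  by exists d; apply: (can_inj mxvecK); rewrite XB BE.
apply: submx_annihilator => w Bw; pose Z := vec_mx w^T.
have wE : w = (mxvec Z)^T by rewrite vec_mxK trmxK.
rewrite wE frobenius_mxvec Xorth ?scalemx0 ?raddf0 // => d.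
have : d *m B *m w = 0 by rewrite -mulmxA Bw mulmx0.
by rewrite BE wE frobenius_mxvec => /matrixP/(_ 0 0); rewrite !mxE.
Qed.

Section Orthogonality.
Variables (R : realFieldType) (n : nat).
Implicit Types (X M Z : 'M[R]_n) (s : 'S_n).

Lemma frobenius_line_sums X M c t : (0 < n)%N ->
  (forall i j, 0 <= M i j) -> line_sums M t ->
  (forall s, (forall i, 0 < M i (s i)) -> \sum_i X i (s i) = c) ->
  frobenius X M = c * t.
Proof.
move=> n_gt0 M0 Mt Xc; have [w w0 Mw] := birkhoff M0 Mt.
have -> : t = \sum_s w s.
  rewrite -(Mt.1 (Ordinal n_gt0)) Mw; exact: (line_sums_sum_perm_mx w).1.
rewrite Mw linear_sum big_distrr; apply: eq_bigr => s _.
rewrite linearZ /= frobenius_perm_mx; have [->|ws] := eqVneq (w s) 0.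
  by rewrite mulr0 mul0r.
by rewrite Xc 1?mulrC // => i; rewrite Mw sum_perm_mx_gt0.
Qed.

Lemma exists_scaleD_ge0 X Z :
  (forall i j, 0 <= X i j) -> (forall i j, X i j = 0 -> Z i j = 0) ->
  exists K, forall i j, 0 <= (K *: X + Z) i j.
Proof.
move=> X0 XZ; exists (\sum_p `|Z p.1 p.2| / X p.1 p.2) => i j.
rewrite !mxE; have [Xij|Xij] := eqVneq (X i j) 0.
  by rewrite Xij mulr0 XZ // addr0.
have X_gt0 : 0 < X i j by rewrite lt_def Xij X0.
set K := \sum_p _; have leK : `|Z i j| / X i j <= K.
  rewrite /K (bigD1 (i, j)) //= lerDl.
  by apply: sumr_ge0 => p _; rewrite divr_ge0.
rewrite -lerBlDr sub0r (le_trans (ler_norm _)) // normrN.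
by rewrite -ler_pdivrMr.
Qed.

(* [K X + Z] and [K X] are both nonnegative on the pattern of [X] and have the
   same line sums, so their products with [X] agree. *)
Lemma frobenius_zero_line_sums X Z c t :
  (forall i j, 0 <= X i j) -> line_sums X t ->
  (forall s, (forall i, X i (s i) != 0) -> \sum_i X i (s i) = c) ->
  line_sums Z 0 -> (forall i j, X i j = 0 -> Z i j = 0) ->
  frobenius X Z = 0.
Proof.
move=> X0 Xt Xc Zt XZ; have [n0|n_gt0] := posnP n.
  by rewrite frobeniusE big1 // => i; have := ltn_ord i; rewrite {2}n0.
have [K KXZ0] := exists_scaleD_ge0 X0 XZ.
have KXZt : line_sums (K *: X + Z) (K * t).
  rewrite -[X in line_sums _ X]addr0.
  by apply: line_sumsD => //; apply: line_sumsZ.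
have XX : frobenius X X = c * t.
  by apply: frobenius_line_sums => // s Xs; apply: Xc => i; rewrite gt_eqF.
have : frobenius X (K *: X + Z) = c * (K * t).
  apply: frobenius_line_sums => // s KXZs; apply: Xc => i.
  by apply: contraTneq (KXZs i) => Xi; rewrite !mxE Xi XZ // mulr0 addr0 ltxx.
by rewrite linearD linearZ /= XX; lra.
Qed.

End Orthogonality.

Section Mask.
Variables (R : comPzSemiRingType) (m n : nat).
Implicit Types A X Z : 'M[R]_(m, n).

Definition mask A Z : 'M[R]_(m, n) :=
  \matrix_(i, j) (if A i j == 1 then Z i j else 0).

Lemma frobenius_mask A X Z : frobenius (mask A X) Z = frobenius X (mask A Z).
Proof.
rewrite !frobeniusE; apply: eq_bigr => i _; apply: eq_bigr => j _.
by rewrite !mxE; case: ifP; rewrite ?mul0r ?mulr0.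
Qed.

End Mask.

Section AdditiveMatrices.
Variables (R : realType) (n : nat).
Implicit Types (A X Z : 'M[R]_n) (s : 'S_n) (u v : 'rV[R]_n).

Lemma avoids_zerosP X s : avoids s (zeros X) <-> forall i, X i (s i) != 0.
Proof.
split=> [/disjoint_setI0/setP sX i|Xs].
  by have := sX (i, s i); rewrite !inE imset_f //= => ->.
rewrite /avoids disjoint_subset; apply/subsetP=> _ /imsetP[i _ ->].
by rewrite !inE /=.
Qed.

Lemma zeros_eqP X Z :
  zeros X = zeros Z <-> forall i j, (X i j == 0) = (Z i j == 0).
Proof.
split=> [/setP XZ i j|XZ]; first by have := XZ (i, j); rewrite !inE.
by apply/setP=> -[i j]; rewrite !inE /= XZ.
Qed.

Lemma zero_one_eq1 A i j : zero_one A -> (A i j == 1) = (A i j != 0).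
Proof. by case/(_ i j)=> ->; rewrite eqxx ?oner_eq0 // eq_sym oner_eq0. Qed.

Lemma trmx_Ymx A u v : (Ymx A u v)^T = Ymx A^T v u.
Proof. by apply/matrixP=> i j; rewrite !mxE addrC. Qed.

Lemma row_sum_tr X i : row_sum X^T i = col_sum X i.
Proof. by apply: eq_bigr => j _; rewrite mxE. Qed.

Lemma row_sum_Ymx A u v i : zero_one A ->
  row_sum (Ymx A u v) i = u 0 i * row_sum A i + \sum_(j | A i j == 1) v 0 j.
Proof.
move=> A01; rewrite /row_sum big_distrr [X in _ + X]big_mkcond -big_split.
apply: eq_bigr => j _; rewrite mxE (zero_one_eq1 _ _ A01).
by have [->|->] := A01 i j; rewrite ?eqxx ?oner_eq0 /= ?mulr0 ?addr0 ?mulr1.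
Qed.

Lemma col_sum_Ymx A u v j : zero_one A ->
  col_sum (Ymx A u v) j = v 0 j * col_sum A j + \sum_(i | A i j == 1) u 0 i.
Proof.
move=> A01; rewrite -row_sum_tr trmx_Ymx row_sum_Ymx; last first.
  by move=> i k; rewrite mxE; apply: A01.
by rewrite row_sum_tr; under eq_bigl do rewrite mxE.
Qed.

Definition Ymx_row A (d : 'rV[R]_(n + n)) : 'M[R]_n :=
  Ymx A (lsubmx d) (rsubmx d).

Lemma Ymx_row_is_linear A : linear (Ymx_row A).
Proof.
move=> a d d'; apply/matrixP=> i j; rewrite !mxE.
by case: ifP => _; [ring | rewrite mulr0 addr0].
Qed.

HB.instance Definition _ A :=
  GRing.isLinear.Build R 'rV[R]_(n + n) 'M[R]_n _ (Ymx_row A)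
    (Ymx_row_is_linear A).

Lemma YmxZ A u v a : Ymx A (a *: u) (a *: v) = a *: Ymx A u v.
Proof.
by apply/matrixP=> i j; rewrite !mxE; case: ifP; rewrite ?mulrDr ?mulr0.
Qed.

Lemma frobenius_Ymx A u v Z : frobenius (Ymx A u v) Z =
  \sum_i u 0 i * row_sum (mask A Z) i + \sum_j v 0 j * col_sum (mask A Z) j.
Proof.
have -> : Ymx A u v = mask A (\matrix_(i, j) (u 0 i + v 0 j)).
  by apply/matrixP=> i j; rewrite !mxE.
rewrite frobenius_mask frobeniusE.
under [X in _ + X]eq_bigr do rewrite /col_sum big_distrr.
rewrite [X in _ + X]exchange_big -big_split; apply: eq_bigr => i _ /=.
rewrite /row_sum big_distrr -big_split; apply: eq_bigr => j _ /=.
by rewrite mxE mulrDl.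
Qed.

Lemma Ymx_of_orthogonal A X : mask A X = X ->
  (forall Z, line_sums (mask A Z) 0 -> frobenius X (mask A Z) = 0) ->
  exists u v, X = Ymx A u v.
Proof.
move=> AX Xorth.
have [Z YZ|d ->] := linear_image_biorthogonal (f := Ymx_row A) (X := X);
  last by exists (lsubmx d), (rsubmx d).
have Yperp u v : frobenius (Ymx A u v) Z = 0.
  by have := YZ (row_mx u v); rewrite /= /Ymx_row row_mxKl row_mxKr.
have sum_delta (g : 'I_n -> R) i :
    \sum_k (delta_mx 0 i : 'rV[R]_n) 0 k * g k = g i.
  rewrite (bigD1 i) //= mxE !eqxx mul1r big1 ?addr0 // => k /negbTE ne.
  by rewrite mxE ne mul0r.
have sum_zero (g : 'I_n -> R) : \sum_k (0 : 'rV[R]_n) 0 k * g k = 0.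
  by apply: big1 => k _; rewrite mxE mul0r.
rewrite -AX frobenius_mask; apply: Xorth; split=> i.
  have := Yperp (delta_mx 0 i) 0.
  by rewrite frobenius_Ymx sum_delta sum_zero addr0.
have := Yperp 0 (delta_mx 0 i).
by rewrite frobenius_Ymx sum_delta sum_zero add0r.
Qed.

Lemma diag_sum_Ymx A u v s : (forall i, A i (s i) = 1) ->
  diag_sum (Ymx A u v) s = \sum_i u 0 i + \sum_j v 0 j.
Proof.
move=> As; rewrite [X in _ + X](reindex_perm s) -big_split.
by apply: eq_bigr => i _; rewrite mxE As eqxx.
Qed.

Lemma RCDS_Ymx A u v : zero_one A ->
  Ypositive A u v -> Yline_sums A u v 1 -> RCDS A (Ymx A u v).
Proof.
move=> A01 Ypos [Yr Yc].
have Y0 i j : (Ymx A u v i j == 0) = (A i j == 0).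
  have [Aij|Aij] := A01 i j; last by rewrite gt_eqF ?Ypos // Aij oner_eq0.
  by rewrite mxE zero_one_eq1 // Aij !eqxx.
have zerosY : zeros (Ymx A u v) = zeros A by apply/zeros_eqP.
split=> //.
  split=> // i j; have [/eqP|] := eqVneq (A i j) 0.
    by rewrite -Y0 => /eqP->.
  by rewrite -zero_one_eq1 // => /eqP/Ypos/ltW.
have diagA s : avoids s (zeros A) -> forall i, A i (s i) = 1.
  by move=> /avoids_zerosP As i; apply/eqP; rewrite zero_one_eq1.
by rewrite zerosY => s s' /diagA As /diagA As'; rewrite !diag_sum_Ymx.
Qed.

Lemma RCDS_orthogonal A X Z : RCDS A X ->
  line_sums Z 0 -> (forall i j, A i j = 0 -> Z i j = 0) -> frobenius X Z = 0.
Proof.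
move=> [[X0 Xr Xc] /zeros_eqP XA Xd] Zt AZ.
have Xt : line_sums X 1 by [].
have [s Xs] := positive_diagonal X0 Xt ltr01.
apply: (frobenius_zero_line_sums (c := diag_sum X s) X0 Xt) => //.
  by move=> s' Xs'; apply: Xd; apply/avoids_zerosP => // i; rewrite gt_eqF.
by move=> i j Xij; apply/AZ/eqP; rewrite -XA Xij.
Qed.

Lemma Ymx_of_RCDS A X : zero_one A -> RCDS A X ->
  exists u v, [/\ Ypositive A u v, Yline_sums A u v 1 & X = Ymx A u v].
Proof.
move=> A01 XR; have [[X0 Xr Xc] /zeros_eqP XA _] := XR.
have AX : mask A X = X.
  apply/matrixP=> i j; rewrite mxE zero_one_eq1 // -XA.
  by case: eqVneq => // ->.
have [Z Zt|u [v XY]] := Ymx_of_orthogonal AX.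
  apply: (RCDS_orthogonal XR Zt) => i j Aij.
  by rewrite mxE zero_one_eq1 // Aij eqxx.
exists u, v; split=> //; last by rewrite /Yline_sums -XY.
by move=> i j Aij; rewrite -XY lt_def X0 XA Aij oner_eq0.
Qed.

Lemma Ypositive_scale A u v a :
  0 < a -> Ypositive A u v -> Ypositive A (a *: u) (a *: v).
Proof. by move=> a0 Ypos i j Aij; rewrite YmxZ mxE mulr_gt0 // Ypos. Qed.

Lemma Yline_sums_scale A u v a b :
  Yline_sums A u v b -> Yline_sums A (a *: u) (a *: v) (a * b).
Proof. by move=> Yls; rewrite /Yline_sums YmxZ; apply: line_sumsZ. Qed.

End AdditiveMatrices.

Theorem theorem2p1 (R : realType) (n : nat) (A : 'M[R]_n) (r s : 'rV[R]_n)
    (A01 : zero_one A) (Afi : fully_indecomposable A)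
    (rE : forall i, r 0 i = row_sum A i)
    (sE : forall j, s 0 j = col_sum A j) :
  (* the two forms of the line-sum condition, related by "i.e." in (i) *)
  (forall (u v : 'rV[R]_n) (alpha : R),
     Yline_sums A u v alpha <->
     (forall i, u 0 i * r 0 i + \sum_(j | A i j == 1) v 0 j = alpha) /\
     (forall j, v 0 j * s 0 j + \sum_(i | A i j == 1) u 0 i = alpha)) /\
  (* (i) *)
  (forall (u v : 'rV[R]_n) (alpha : R),
     0 < alpha -> Ypositive A u v -> Yline_sums A u v alpha ->
     RCDS A (alpha^-1 *: Ymx A u v)) /\
  (* (ii) *)
  (forall X : 'M[R]_n, RCDS A X ->
     exists (u v : 'rV[R]_n) (alpha : R),
       [/\ 0 < alpha, Ypositive A u v, Yline_sums A u v alpha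
         & X = alpha^-1 *: Ymx A u v]).
Proof.
split; [|split] => [u v alpha|u v alpha a_gt0 Ypos Yls|X].
- split=> -[Yr Yc]; split=> i.
  + by rewrite rE -row_sum_Ymx.
  + by rewrite sE -col_sum_Ymx.
  + by rewrite row_sum_Ymx // -rE.
  + by rewrite col_sum_Ymx // -sE.
- rewrite -YmxZ; apply: RCDS_Ymx => //.
    by apply: Ypositive_scale; rewrite ?invr_gt0.
  by rewrite -(mulVf (lt0r_neq0 a_gt0)); apply: Yline_sums_scale.
- move=> /(Ymx_of_RCDS A01)[u [v [Ypos Yls XY]]].
  by exists u, v, 1; rewrite invr1 scale1r.
Qed.
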